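(* A graph $G$ is a WTD(2) graph with $\rho(G)=2$ if and only if $G\in W_2$.
   Context: Graphs are finite, simple and nonempty (except where stated otherwise). A total dominating set (TDS) of a graph $G$ with no isolated vertices is a set $S\subseteq V(G)$ such that every vertex of $G$ is adjacent to at least one element of $S$; it is minimal if it contains no other TDS. $\gamma_t(G)$ is the minimum size of a TDS. $G$ is well-totally-dominated (WTD) if it has no isolated vertices and all its minimal TDSs have the same size. A WTD(2) graph is a WTD graph with $\gamma_t(G)=2$. $N(v)$ is the open neighborhood of $v$ and $N[v]=N(v)\cup\{v\}$. A set $S\subseteq V(G)$ is a packing of $G$ if $N[u]\cap N[v]=\emptyset$ for all distinct $u,v\in S$; the packing number $\rho(G)$ is the maximum size of a packing of $G$. A vertex cover of a graph $H$ is a set of vertices containing an endpoint of every edge of $H$; $MVC(H)$ is the set of all (inclusion-)minimal vertex covers of $H$. $W_2$ is the set of graphs (up to isomorphism) obtained as follows. Step 1: Choose a bipartite graph $H$ with no isolated vertices. Step 2: For every $S\in MVC(H)$, choose a new vertex $v_S$ (distinct for distinct $S$) and draw edges from $v_S$ to every vertex in $S$. Step 3: For each edge $uv$ in $H$ and every $w\in V(H)\setminus\{u,v\}$, add the edges $wu$ and/or $wv$ if needed to make sure $w$ is adjacent to at least one of $u$ and $v$ (one is free to add one or both of these edges, so the edges added between vertices of $V(H)$ may be any set of edges such that, in the resulting graph, every $w\in V(H)\setminus\{u,v\}$ is adjacent to at least one of $u,v$ for every edge $uv$ of $H$). Step 4: Choose a new graph $H'$ (which might be the empty graph) disjoint from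 the current graph. Then for each edge $uv$ in $H$ and every $w\in V(H')$, draw at least one of the edges $wu$ and $wv$. No other edges are added; in particular $N(v_S)=S$ in the final graph. *)

(* Defs.v *)
From HB Require Import structures.
From mathcomp Require Import all_boot.

Set Implicit Arguments.
Unset Strict Implicit.
Unset Printing Implicit Defensive.

(* Finite simple graphs.  The vertex set may be empty: nonemptiness is assumed
   explicitly, so that the same type also serves where the empty graph is
   allowed. *)
Record sgraph := SGraph {
  vertex :> finType;
  adj : rel vertex;
  adj_sym : symmetric adj;
  adj_irrefl : irreflexive adj
}.

Definition isomorphic (G1 G2 : sgraph) : Prop :=
  exists2 f : G1 -> G2, bijective f & forall x y, adj (f x) (f y) = adj x y.

Section Graph.
Variable G : sgraph.
Implicit Types (u v : G) (S : {set G}).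

Definition open_nbh v : {set G} := [set w | adj v w].
Definition closed_nbh v : {set G} := v |: open_nbh v.

Definition no_isolated : Prop := forall v, open_nbh v != set0.

Definition tds S : bool := [forall v, exists u in S, adj v u].
Definition minimal_tds S : bool := minset tds S.

(* Meaningful only when G has no isolated vertices, so that the default value
   [set: G] is a total dominating set. *)
Definition total_domination_number : nat :=
  #|[arg min_(S < [set: G] | tds S) #|S| ]|.

Definition wtd : Prop :=
  no_isolated /\
  forall S1 S2, minimal_tds S1 -> minimal_tds S2 -> #|S1| = #|S2|.

Definition wtd2 : Prop := wtd /\ total_domination_number = 2.

Definition packing S : bool :=
  [forall u in S, forall v in S,
     (u != v) ==> (closed_nbh u :&: closed_nbh v == set0)].
Definition packing_number : nat := \max_(S : {set G} | packing S) #|S|.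

Definition vertex_cover S : bool :=
  [forall u, forall v, adj u v ==> (u \in S) || (v \in S)].
Definition MVC : {set {set G}} := [set S | minset vertex_cover S].

Definition bipartite : Prop :=
  exists A : {set G}, forall u v, adj u v -> (u \in A) != (v \in A).

End Graph.

Section W2.
Variables (H H' : sgraph).
(* [add] is the set of edges added between vertices of H, [cross] the set of
   edges drawn between H and H'. *)
Variables (add : rel H) (cross : H -> H' -> bool).
Hypotheses (add_sym : symmetric add) (add_irrefl : irreflexive add).

Definition core_adj : rel H := fun u v => adj u v || add u v.

(* The vertices are those of H, one vertex v_S for each S in MVC H (namely
   inl (inr S)), and those of H'. *)
Definition W2_vertex : finType := (H + {S : {set H} | S \in MVC H} + H')%type.

Definition W2_adj : rel W2_vertex := fun x y =>
  match x, y with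
  | inl (inl u), inl (inl v) => core_adj u v
  | inl (inl u), inl (inr C) => u \in val C
  | inl (inr C), inl (inl u) => u \in val C
  | inl (inl u), inr w => cross u w
  | inr w, inl (inl u) => cross u w
  | inr w, inr w' => adj w w'
  | _, _ => false
  end.

Lemma W2_adj_sym : symmetric W2_adj.
Proof.
move=> [[u|S]|w] [[u'|S']|w'] //=; last exact: adj_sym.
by rewrite /core_adj adj_sym add_sym.
Qed.

Lemma W2_adj_irrefl : irreflexive W2_adj.
Proof.
move=> [[u|S]|w] //=; last exact: adj_irrefl.
by rewrite /core_adj adj_irrefl add_irrefl.
Qed.

Definition W2_graph : sgraph := SGraph W2_adj_sym W2_adj_irrefl.

Definition add_dominates : Prop :=
  forall u v, adj u v ->
  forall w, w != u -> w != v -> core_adj w u || core_adj w v.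

Definition cross_dominates : Prop :=
  forall u v, adj u v -> forall w, cross u w || cross v w.

End W2.

Definition in_W2 (G : sgraph) : Prop :=
  exists (H H' : sgraph) (add : rel H) (cross : H -> H' -> bool)
         (add_sym : symmetric add) (add_irrefl : irreflexive add),
  [/\ 0 < #|H|, bipartite H & no_isolated H] /\
  [/\ add_dominates add, cross_dominates cross &
      isomorphic G (W2_graph cross add_sym add_irrefl)].

(* Main.v *)
(** If the disjoint closed neighbourhoods [N[a]], [N[b]] witness the packing
    number, let [H] be the graph whose edges are the pairs [uv] that totally
    dominate [G].  Each edge of [H] has one end in [N(a)] and the other in
    [N(b)], so [H] is bipartite.  A set of vertices contains a total dominating
    set iff it contains an edge of [H]; hence the complement of a minimal vertex
    cover [S] of [H] misses the neighbourhood of some vertex [x], and since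
    [N(x)] meets every edge of [H], [N(x) = S] by minimality.  Such an [x] lies
    outside [H], and one of them is taken as [v_S].
    Conversely, in a graph of [W_2] a total dominating set meets every
    [N(v_S) = S], so the vertices of [H] outside it form no vertex cover: it
    contains an edge of [H], which is already totally dominating. *)
Require Import Defs.
From HB Require Import structures.
From mathcomp Require Import all_boot.

Set Implicit Arguments.
Unset Strict Implicit.
Unset Printing Implicit Defensive.

(** * Total dominating sets, WTD(2) graphs and packings *)

Section TotalDomination.
Variable G : sgraph.
Implicit Types (u v w x y a b : G) (S T : {set G}).

Lemma tdsP S : reflect (forall v, exists2 u, u \in S & adj v u) (tds S).
Proof.
apply: (iffP forallP) => [h v|h v]; first by case/exists_inP: (h v) => u; exists u.
by apply/exists_inP; case: (h v) => u; exists u.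
Qed.

Lemma tds_pairP u v :
  reflect (forall w, adj w u || adj w v) (tds [set u; v]).
Proof.
apply: (iffP (tdsP _)) => h w.
  by case: (h w) => x /set2P[]-> ->; rewrite ?orbT.
by case/orP: (h w); [exists u | exists v]; rewrite ?set21 ?set22.
Qed.

Lemma tds_pair_adj u v : tds [set u; v] -> adj u v.
Proof. by move/tds_pairP/(_ u); rewrite adj_irrefl. Qed.

Lemma tds_sub S T : S \subset T -> tds S -> tds T.
Proof.
move=> /subsetP sST /tdsP h; apply/tdsP => v.
by case: (h v) => u /sST; exists u.
Qed.

(** An element [u] of [S] must itself have a neighbour in [S], and this is a second element. *)
Lemma card_tds_gt1 S : 0 < #|G| -> tds S -> 1 < #|S|.
Proof.
move=> /card_gt0P[v _] /tdsP h; case: (h v) => u uS _; case: (h u) => w wS uw.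
apply/card_gt1P; exists u, w; split=> //.
by apply: contraTneq uw => ->; rewrite adj_irrefl.
Qed.

Lemma card_tds_pair u v : tds [set u; v] -> #|[set u; v]| = 2.
Proof.
move=> /tds_pair_adj uv; rewrite cards2.
by rewrite (contraTneq _ uv) // => ->; rewrite adj_irrefl.
Qed.

Lemma minimal_tds_pair u v : tds [set u; v] -> minimal_tds [set u; v].
Proof.
move=> huv; apply/minsetP; split=> // T hT sT; apply/eqP.
rewrite eqEcard sT (card_tds_pair huv) card_tds_gt1 //.
by apply/card_gt0P; exists u.
Qed.

(** A totally dominating pair is a minimal TDS, no TDS being smaller. Equal sizes then force every
    minimal TDS to be a pair, and every TDS contains a minimal one. From here on minimality of TDSs
    is replaced by pairs. *)
Lemma wtd2P : 0 < #|G| ->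
  wtd2 G <-> (exists u v, tds [set u; v]) /\
             (forall S, tds S ->
                exists u v, [/\ u \in S, v \in S & tds [set u; v]]).
Proof.
move=> G_gt0; split.
  case=> -[noiso hmin] htdn.
  (* The default value of the arg min has to be a TDS; here the absence of isolated vertices
     enters. *)
  have tdsT : tds [set: G].
    apply/tdsP => v; case/set0Pn: (noiso v) => u; rewrite inE => uv.
    by exists u; rewrite ?inE.
  have [u [v huv]] : exists u v, tds [set u; v].
    move: htdn; rewrite /total_domination_number; case: arg_minnP => // S hS _.
    by move/eqP/cards2P => [u [v [_ ES]]]; exists u, v; rewrite -ES.
  split; first by exists u, v.
  move=> S /minset_exists[T Tmin sTS].
  have /eqP/cards2P[x [y [_ ET]]] : #|T| = 2.
    by rewrite (hmin _ _ Tmin (minimal_tds_pair huv)) card_tds_pair.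
  exists x, y; rewrite -ET; split; last exact: minsetp Tmin.
    by apply: (subsetP sTS); rewrite ET set21.
  by apply: (subsetP sTS); rewrite ET set22.
case=> -[u [v huv]] hS.
have hmin2 S : minimal_tds S -> #|S| = 2.
  case/minsetP => /hS[x [y [xS yS hxy]]] Smin; rewrite -(Smin _ hxy).
    exact: card_tds_pair.
  by apply/subsetP => z /set2P[]->.
split; first split.
- move=> w; apply/set0Pn; move/tds_pairP: huv => /(_ w) /orP[] h.
    by exists u; rewrite inE.
  by exists v; rewrite inE.
- by move=> S1 S2 /hmin2-> /hmin2->.
rewrite /total_domination_number; case: arg_minnP => [|S StdS Smin].
  by apply: tds_sub huv; apply: subsetT.
by apply/eqP; rewrite eqn_leq card_tds_gt1 // -(card_tds_pair huv) Smin.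
Qed.

(* Two elements of a packing cannot be dominated by the same end of [uv]. *)
Lemma card_packing_le2 u v S : tds [set u; v] -> packing S -> #|S| <= 2.
Proof.
move=> /tds_pairP huv /forall_inP hS.
have inj : {in S &, injective (fun x => adj x u)}.
  move=> x y xS yS /= exy; apply/eqP.
  have [w xw yw] : exists2 w, adj x w & adj y w.
    case xu: (adj x u); first by exists u; rewrite // -exy.
    by exists v; [have := huv x | have := huv y]; rewrite -?exy xu.
  have /forall_inP/(_ y yS) := hS x xS; apply: contraLR => ->.
  by apply/set0Pn; exists w; rewrite !inE xw yw !orbT.
by rewrite -(card_in_imset inj) -card_bool max_card.
Qed.

Lemma packing_number2P u v : tds [set u; v] ->
  packing_number G = 2 <->
  exists a b, a != b /\ closed_nbh a :&: closed_nbh b = set0.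
Proof.
move=> huv; split.
  rewrite /packing_number => h2.
  (* The maximum is attained as soon as some packing exists. *)
  have p0 : packing (set0 : {set G}) by apply/forall_inP => x; rewrite inE.
  have [S pS cS] := @eq_bigmax_cond _ (fun S => packing S) (fun S => #|S|)
    (introT card_gt0P (ex_intro _ set0 p0)).
  move: cS; rewrite h2 => /esym/eqP/cards2P[a [b [nab ES]]].
  exists a, b; split=> //; move/forall_inP/(_ a): pS; rewrite ES set21.
  by move/(_ isT)/forall_inP/(_ b); rewrite set22 nab => /(_ isT)/eqP.
case=> a [b [nab hab]].
have pab : packing [set a; b].
  apply/forall_inP => x xab; apply/forall_inP => y yab; apply/implyP.
  by case/set2P: xab => ->; case/set2P: yab => ->;
    rewrite ?eqxx // ?hab // setIC hab.
apply/eqP; rewrite eqn_leq; apply/andP; split.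
  by apply/bigmax_leqP => S; apply: card_packing_le2 huv.
by apply: bigmax_sup pab _; rewrite cards2 nab.
Qed.

End TotalDomination.

(** * Minimal vertex covers *)

Section VertexCover.
Variable H : sgraph.
Implicit Types (u v : H) (S T : {set H}).

Lemma vertex_coverP S :
  reflect (forall u v, adj u v -> (u \in S) || (v \in S)) (vertex_cover S).
Proof.
apply: (iffP forallP) => h u; first by move=> v; move/forallP/(_ v)/implyP: (h u).
by apply/forallP => v; apply/implyP; apply: h.
Qed.

Lemma MVC_exists S : vertex_cover S -> exists2 T, T \in MVC H & T \subset S.
Proof. by case/minset_exists => T; exists T; rewrite // inE. Qed.

Lemma MVC_cover S : S \in MVC H -> vertex_cover S.
Proof. by rewrite inE => /minsetp. Qed.

Lemma MVC_min S T : S \in MVC H -> vertex_cover T -> T \subset S -> T = S.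
Proof. by rewrite inE => /minsetP[_]; apply. Qed.

(** If the complement of [T] were a vertex cover, it would contain a minimal one, which [T] would
    miss. *)
Lemma MVC_transversal_edge T :
  (forall S, S \in MVC H -> exists2 u, u \in S & u \in T) ->
  exists u v, [/\ u \in T, v \in T & adj u v].
Proof.
move=> h; case vcT: (vertex_cover (~: T)).
  case: (MVC_exists vcT) => S /h[u uS uT] /subsetP/(_ u uS).
  by rewrite inE uT.
move/negbT: vcT => /forallPn[u /forallPn[v]].
by rewrite negb_imply negb_or !inE !negbK => /and3P[uv uT vT]; exists u, v.
Qed.

End VertexCover.

(** * Invariance under isomorphism *)

Section Isomorphic.
Variables G1 G2 : sgraph.

Lemma isomorphic_sym : isomorphic G1 G2 -> isomorphic G2 G1.
Proof.
case=> f [g fK gK] hf; exists g; first by exists f.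
by move=> x y; rewrite -hf !gK.
Qed.

Lemma imset_closed_nbh (f : G1 -> G2) v :
  bijective f -> (forall x y, adj (f x) (f y) = adj x y) ->
  closed_nbh (f v) = f @: closed_nbh v.
Proof.
case=> g fK gK hf; apply/setP => w; have injf := can_inj fK.
by rewrite -(gK w) (mem_imset _ _ injf) !inE (inj_eq injf) hf.
Qed.

Lemma imset_tds (f : G1 -> G2) (S : {set G1}) :
  bijective f -> (forall x y, adj (f x) (f y) = adj x y) ->
  tds S -> tds (f @: S).
Proof.
case=> g fK gK hf /tdsP h; apply/tdsP => w; case: (h (g w)) => u uS wu.
by exists (f u); [apply: imset_f | rewrite -(gK w) hf].
Qed.

End Isomorphic.

(** Totally dominating pairs and closed neighbourhoods are carried along [f]. A TDS of [G2] is
    pulled back along the inverse, and the pair found inside it is pushed forward. *)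
Lemma isomorphic_wtd2_packing (G1 G2 : sgraph) :
  0 < #|G1| -> isomorphic G1 G2 ->
  wtd2 G1 /\ packing_number G1 = 2 -> wtd2 G2 /\ packing_number G2 = 2.
Proof.
move=> G1_gt0 [f bf hf] [/(wtd2P G1_gt0)[[u [v huv]] hS]].
have tdsf x y : tds [set x; y] -> tds [set f x; f y].
  by move/(imset_tds bf hf); rewrite imsetU1 imset_set1.
move=> /(packing_number2P huv)[a [b [nab hab]]].
have injf : injective f by apply: bij_inj.
have G2_gt0 : 0 < #|G2| by apply/card_gt0P; exists (f u).
split; last first.
  apply/(packing_number2P (tdsf _ _ huv)); exists (f a), (f b).
  rewrite (inj_eq injf) nab !(imset_closed_nbh _ bf hf) -imsetI ?hab ?imset0 //.
  by move=> ? ? _ _; apply: injf.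
apply/(wtd2P G2_gt0); split; first by exists (f u), (f v); apply: tdsf.
move=> S; case: (bf) => g fK gK.
have bg : bijective g by exists f.
have hg x y : adj (g x) (g y) = adj x y by rewrite -hf !gK.
move=> /(imset_tds bg hg)/hS[_ [_ [/imsetP[x xS ->] /imsetP[y yS ->] /tdsf]]].
by rewrite !gK; exists x, y.
Qed.

(** * Graphs of $W_2$ are WTD(2) with packing number 2 *)

Section W2Graph.
Variables (H H' : sgraph) (add : rel H) (cross : H -> H' -> bool).
Hypotheses (add_sym : symmetric add) (add_irrefl : irreflexive add).
Hypotheses (add_dom : add_dominates add) (cross_dom : cross_dominates cross).
Local Notation W := (W2_graph cross add_sym add_irrefl).

(** The ends dominate each other and Step 3 handles the rest of $H$; $v_S$ is dominated because $S$
    covers [uv], and $H'$ by Step 4. *)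
Lemma W2_tds_edge (u v : H) :
  adj u v -> @tds W [set inl (inl u); inl (inl v)].
Proof.
move=> uv; apply/tds_pairP => -[[w|S]|w] /=.
- case: (eqVneq w u) => [->|wu]; first by rewrite /core_adj uv orbT.
  case: (eqVneq w v) => [->|wv]; first by rewrite /core_adj adj_sym uv.
  exact: add_dom.
- by move/vertex_coverP: (MVC_cover (valP S)); apply.
- exact: cross_dom.
Qed.

Lemma W2_wtd2_packing : 0 < #|H| -> bipartite H -> no_isolated H ->
  wtd2 W /\ packing_number W = 2.
Proof.
move=> /card_gt0P[u _] [A hA] /(_ u)/set0Pn[v]; rewrite inE => uv.
have W_gt0 : 0 < #|W| by apply/card_gt0P; exists (inl (inl u)).
have huv := W2_tds_edge uv; split.
  apply/(wtd2P W_gt0); split; first by exists (inl (inl u)), (inl (inl v)).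
  move=> T /tdsP hT.
  have [|x [y]] := @MVC_transversal_edge H [set x | inl (inl x) \in T].
    move=> S hS; case: (hT (inl (inr (Sub S hS)))) => -[[x|C]|w] //= xT xS.
    by exists x; rewrite ?inE.
  rewrite !inE => -[xT yT xy]; exists (inl (inl x)), (inl (inl y)).
  by split=> //; apply: W2_tds_edge.
(* Both colour classes are vertex covers. Minimal covers [S] and [S'] inside them are disjoint, and
   their vertices $v_S$, $v_{S'}$ form the packing. *)
have [|S hS /subsetP sSA] := @MVC_exists H A.
  by apply/vertex_coverP => x y /hA; case: (x \in A); case: (y \in A).
have [|S' hS' /subsetP sSA'] := @MVC_exists H (~: A).
  apply/vertex_coverP => x y /hA; rewrite !inE.
  by case: (x \in A); case: (y \in A).
have disj x : x \in S -> x \in S' -> False.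
  by move=> /sSA xA /sSA'; rewrite inE xA.
(* Being disjoint, equal covers would be empty and miss the edge [uv]. *)
have nSS' : S != S'.
  apply/eqP => eSS'; move/MVC_cover/vertex_coverP/(_ u v uv): (hS).
  by case/orP => h; apply: (disj _ h); rewrite -eSS'.
apply/(packing_number2P huv).
exists (inl (inr (Sub S hS))), (inl (inr (Sub S' hS'))).
have nvSS' : inl (inr (Sub S hS)) != inl (inr (Sub S' hS')) :> W.
  by apply: contra_neq nSS' => -[].
split=> //; apply/setP => w; rewrite !inE; apply/negbTE.
apply/negP => /andP[/orP[/eqP->|]].
  by case/orP => // /eqP e; rewrite e eqxx in nvSS'.
case: w => [[w|C]|w] //= wS; rewrite /= => wS'.
exact: disj wS wS'.
Qed.

End W2Graph.

(** * The graph of totally dominating pairs *)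

Section TdsGraph.
Variable G : sgraph.

(** Keeping only these vertices leaves the graph of pairs without isolated vertices. *)
Definition tds_vertices : {set G} := [set x | [exists y, tds [set x; y]]].
Local Notation core := {x : G | x \in tds_vertices}.

Definition tds_adj : rel core := fun x y => tds [set val x; val y].

Fact tds_adj_sym : symmetric tds_adj.
Proof. by move=> x y; rewrite /tds_adj setUC. Qed.

Fact tds_adj_irrefl : irreflexive tds_adj.
Proof. by move=> x; apply/negP => /tds_pair_adj; rewrite adj_irrefl. Qed.

Definition tds_graph : sgraph := SGraph tds_adj_sym tds_adj_irrefl.

Lemma tds_verticesP (x : G) :
  reflect (exists y, tds [set x; y]) (x \in tds_vertices).
Proof. by rewrite inE; apply: existsP. Qed.

Lemma tds_pair_vertices (x y : G) :
  tds [set x; y] -> x \in tds_vertices /\ y \in tds_vertices.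
Proof.
move=> h; split; apply/tds_verticesP; first by exists y.
by exists x; rewrite setUC.
Qed.

Lemma tds_graph_no_isolated : no_isolated tds_graph.
Proof.
move=> [x xV]; case/tds_verticesP: (xV) => y xy.
have [_ yV] := tds_pair_vertices xy.
by apply/set0Pn; exists (Sub y yV); rewrite inE.
Qed.

Lemma tds_graph_open_nbh_cover (x : G) :
  @vertex_cover tds_graph [set u : core | adj x (val u)].
Proof. by apply/vertex_coverP => u v /tds_pairP/(_ x); rewrite !inE. Qed.

End TdsGraph.

(** * Induced subgraphs, possibly empty, to serve as $H'$ *)

Section InducedSubgraph.
Variables (G : sgraph) (S : {set G}).

Definition induced_adj : rel {x : G | x \in S} := fun x y => adj (val x) (val y).

Fact induced_adj_sym : symmetric induced_adj.
Proof. by move=> x y; apply: adj_sym. Qed.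

Fact induced_adj_irrefl : irreflexive induced_adj.
Proof. by move=> x; apply: adj_irrefl. Qed.

Definition induced : sgraph := SGraph induced_adj_sym induced_adj_irrefl.

End InducedSubgraph.

(** * Recovering the $W_2$ construction *)

Section Decomposition.
Variable G : sgraph.
Local Notation core := {x : G | x \in tds_vertices G}.

Hypothesis tds_has_pair : forall S : {set G}, tds S ->
  exists u v, [/\ u \in S, v \in S & tds [set u; v]].
Variables a b : G.
Hypothesis disj_ab : closed_nbh a :&: closed_nbh b = set0.

Lemma closed_nbh_disjoint w : w \in closed_nbh a -> w \notin closed_nbh b.
Proof.
move=> wa; have /setP/(_ w) := disj_ab.
by rewrite !inE in wa *; rewrite wa => /= ->.
Qed.

Lemma adj_disjoint w : adj a w -> adj b w = false.
Proof.
move=> aw; have := @closed_nbh_disjoint w.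
by rewrite !inE aw orbT negb_or => /(_ isT)/andP[_ /negPf].
Qed.

(** Since [a] and [b] have no common neighbour, they are dominated by different ends of the pair. *)
Lemma tds_pair_separated (u v : G) : tds [set u; v] ->
  (adj a u && adj b v) || (adj a v && adj b u).
Proof.
move/tds_pairP => h; move: (h a) (h b) => /orP[] h1 /orP[] h2.
- by rewrite adj_disjoint in h2.
- by rewrite h1 h2.
- by rewrite h1 h2 orbT.
- by rewrite adj_disjoint in h2.
Qed.

Lemma tds_graph_bipartite : bipartite (tds_graph G).
Proof.
exists [set u : core | adj a (val u)] => u v /tds_pair_separated; rewrite !inE.
case/orP=> /andP[-> h].
  by apply: contraTneq h => /esym/adj_disjoint->.
by apply: contraTneq h => /adj_disjoint->.
Qed.

(** A member of a pair is adjacent to [a] or [b], whereas [a] and [b] are not adjacent: otherwise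
    [b] would lie in both closed neighbourhoods. *)
Lemma packing_notin_tds_vertices :
  a \notin tds_vertices G /\ b \notin tds_vertices G.
Proof.
have nab : adj a b = false.
  apply/negP => ab; have := @closed_nbh_disjoint b.
  by rewrite !inE ab eqxx orbT => /(_ isT).
split; apply/negP => /tds_verticesP[y /tds_pair_separated].
  by rewrite adj_irrefl (adj_sym b a) nab andbF.
by rewrite adj_irrefl nab andbF.
Qed.

(** The boolean equality lets [xchoose] pick the vertex $v_S$. *)
Lemma MVC_open_nbh (S : {set core}) :
  S \in MVC (tds_graph G) -> exists x, open_nbh x == val @: S.
Proof.
move=> hS.
(* A TDS avoiding [S] would contain a pair, that is, an edge not covered by [S]. *)
have : ~~ tds (~: (val @: S)).
  apply/negP => /tds_has_pair[u [v [uS vS huv]]].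
  have [uV vV] := tds_pair_vertices huv.
  move/vertex_coverP/(_ (Sub u uV) (Sub v vV) huv): (MVC_cover hS).
  by case/orP => /(imset_f val) /= h; [move: uS | move: vS]; rewrite inE h.
case/forallPn => x /exists_inPn hx; exists x.
have hxS w : adj x w -> w \in val @: S.
  by move=> xw; apply: contraTT xw => wS; apply: hx; rewrite inE.
(* The neighbours of [x] in the core form a cover contained in [S], so minimality gives equality. *)
have <- : [set u : core | adj x (val u)] = S.
  apply: (MVC_min hS) (tds_graph_open_nbh_cover x) _.
  apply/subsetP => u; rewrite inE => /hxS.
  by rewrite (mem_imset _ _ val_inj).
rewrite eqEsubset; apply/andP; split; apply/subsetP => w; rewrite inE.
  move=> xw; case/imsetP: (hxS w xw) => u _ ew.
  by rewrite ew imset_f // inE -ew.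
by case/imsetP => u; rewrite inE => h ->.
Qed.

Local Notation cover := {S : {set core} | S \in MVC (tds_graph G)}.

Definition cover_vertex (C : cover) : G := xchoose (MVC_open_nbh (valP C)).

Lemma open_nbh_cover_vertex C : open_nbh (cover_vertex C) = val @: val C.
Proof. exact/eqP/(xchooseP (MVC_open_nbh (valP C))). Qed.

Lemma cover_vertex_inj : injective cover_vertex.
Proof.
move=> C D e; apply/val_inj/(imset_inj val_inj).
by rewrite -!open_nbh_cover_vertex e.
Qed.

Lemma adj_cover_vertex C w : adj (cover_vertex C) w -> w \in tds_vertices G.
Proof.
have /setP/(_ w) := open_nbh_cover_vertex C.
by rewrite inE => -> /imsetP[u _ ->]; apply: valP.
Qed.

(* All neighbours of [v_S] lie in [H], whereas every vertex of [H] is adjacent to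
   [a] or [b], which are outside [H]. *)
Lemma cover_vertex_notin C : cover_vertex C \notin tds_vertices G.
Proof.
have [aV bV] := packing_notin_tds_vertices.
apply/negP => /tds_verticesP[y /tds_pair_separated].
rewrite !(adj_sym _ (cover_vertex C)).
by case/orP=> /andP[h1 h2]; [move: aV | move: bV]; rewrite (@adj_cover_vertex C).
Qed.

(** Besides the chosen $v_S$, other vertices with neighbourhood $S$ may exist; they fall into
    $H'$. *)
Definition remainder : {set G} :=
  [set w | (w \notin tds_vertices G) && (w \notin codom cover_vertex)].

(** Edges of $H$ are included: totally dominating pairs are adjacent, so [core_adj] becomes exactly
    adjacency in [G]. *)
Definition core_add : rel (tds_graph G) := fun u v => adj (val u) (val v).
Definition core_cross (u : tds_graph G) (w : induced remainder) : bool :=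
  adj (val u) (val w).

Fact core_add_sym : symmetric core_add.
Proof. by move=> u v; apply: adj_sym. Qed.

Fact core_add_irrefl : irreflexive core_add.
Proof. by move=> u; apply: adj_irrefl. Qed.

Local Notation W := (W2_graph core_cross core_add_sym core_add_irrefl).

Definition of_W2 (x : W) : G :=
  match x with
  | inl (inl u) => val u
  | inl (inr C) => cover_vertex C
  | inr w => val w
  end.

Lemma of_W2_adj x y : adj (of_W2 x) (of_W2 y) = adj x y.
Proof.
have hcv C (u : core) : adj (cover_vertex C) (val u) = (u \in val C).
  have /setP/(_ (val u)) := open_nbh_cover_vertex C.
  by rewrite inE (mem_imset _ _ val_inj).
(* This excludes edges from $v_S$ to any other cover vertex or to $H'$. *)
have hcv0 C w : w \notin tds_vertices G -> adj (cover_vertex C) w = false.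
  by move=> wV; apply: contraNF wV => /adj_cover_vertex.
have hrem (w : induced remainder) : val w \notin tds_vertices G.
  by have := valP w; rewrite inE => /andP[].
case: x y => [[u|C]|w] [[v|D]|z] //=.
- by rewrite /core_adj /core_add; case uv: (adj u v) => //; apply: tds_pair_adj.
- by rewrite adj_sym hcv.
- exact: hcv.
- by rewrite hcv0 ?cover_vertex_notin.
- exact: hcv0 (hrem z).
- exact: adj_sym.
- by rewrite adj_sym (hcv0 _ _ (hrem w)).
Qed.

Lemma of_W2_inj : injective of_W2.
Proof.
have hcv C x : x = cover_vertex C -> x \notin tds_vertices G.
  by move=> ->; apply: cover_vertex_notin.
have hrem (w : induced remainder) x : x = val w ->
    (x \notin tds_vertices G) /\ (x \notin codom cover_vertex).
  by move=> ->; have := valP w; rewrite inE => /andP[].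
case=> [[u|C]|w] [[v|D]|z] //= e.
- by move/val_inj: e => ->.
- by case/negP: (hcv D _ e); apply: valP.
- by case/negP: (hrem z _ e).1; apply: valP.
- by case/negP: (hcv C _ (esym e)); apply: valP.
- by rewrite (cover_vertex_inj e).
- by case/negP: (hrem z _ e).2; apply: codom_f.
- by case/negP: (hrem w _ (esym e)).1; apply: valP.
- by case/negP: (hrem w _ (esym e)).2; apply: codom_f.
- by move/val_inj: e => ->.
Qed.

Lemma of_W2_surj x : exists y, of_W2 y = x.
Proof.
case xV: (x \in tds_vertices G); first by exists (inl (inl (Sub x xV))).
case xC: (x \in codom cover_vertex).
  by case/codomP: xC => C ->; exists (inl (inr C)).
have xR : x \in remainder by rewrite inE xV xC.
by exists (inr (Sub x xR)).
Qed.

Lemma of_W2_bij : bijective of_W2.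
Proof.
have surj x : exists y, of_W2 y == x.
  by have [y <-] := of_W2_surj x; exists y.
have gK : cancel (fun x => xchoose (surj x)) of_W2.
  by move=> x; apply/eqP/(xchooseP (surj x)).
by exists (fun x => xchoose (surj x)) => // y; apply: of_W2_inj; rewrite gK.
Qed.

Lemma tds_pair_in_W2 (u v : G) : tds [set u; v] -> in_W2 G.
Proof.
move=> huv; have [uV _] := tds_pair_vertices huv.
exists (tds_graph G), (induced remainder), core_add, core_cross.
exists core_add_sym, core_add_irrefl; split; split.
- by apply/card_gt0P; exists (Sub u uV).
- exact: tds_graph_bipartite.
- exact: tds_graph_no_isolated.
- move=> x y /tds_pairP xy w _ _; rewrite /core_adj.
  by case/orP: (xy (val w)) => h; apply/orP; [left | right]; rewrite /core_add h orbT.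
- by move=> x y /tds_pairP xy w; rewrite /core_cross !(adj_sym _ (val w)).
- by apply: isomorphic_sym; exists of_W2; [apply: of_W2_bij | apply: of_W2_adj].
Qed.

End Decomposition.

Theorem theorem3p5 (G : sgraph) (G_nonempty : 0 < #|G|) :
  (wtd2 G /\ packing_number G = 2) <-> in_W2 G.
Proof.
split.
  case=> /(wtd2P G_nonempty)[[u [v huv]] hS].
  move=> /(packing_number2P huv)[a [b [_ hab]]].
  exact: (tds_pair_in_W2 hS hab huv).
case=> [H [H' [add [cross [add_sym [add_irrefl]]]]]].
case=> -[H_gt0 Hbip Hiso] [hadd hcross /isomorphic_sym iso].
apply: (isomorphic_wtd2_packing _ iso); last exact: W2_wtd2_packing.
by case/card_gt0P: H_gt0 => u _; apply/card_gt0P; exists (inl (inl u)).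
Qed.
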